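(* Let $N\ge1$, $d\ge2$, let $\bm{p}=(p_1,\ldots,p_d)$ be a probability distribution with all $p_j>0$, and let $\bm{u}=\{u^{(l)}\}_{l=0}^{d-1}$ be real functions on $\{1,\ldots,d\}$ with $u^{(0)}\equiv1$ that are orthonormal on $\bm{p}$: $\sum_{i=1}^d u^{(l)}_iu^{(m)}_ip_i=\delta_{lm}$. For $i,l,k=0,\ldots,d-1$ let $c(i,l,k)=\sum_{j=1}^du_j^{(i)}u_j^{(l)}u_j^{(k)}p_j$, and for $\bm{x}\in\mathbb{Z}_{\ge0}^d$, $|\bm{x}|=N$, let $u_i=\sum_{j=1}^du_j^{(i)}x_j$, $i=1,\ldots,d-1$. Then for all such $\bm{x}$ and all $\bm{n}\in\mathbb{Z}_{\ge0}^{d-1}$ with $|\bm{n}|\le N$: for $j=1,\ldots,d$, \begin{align*} x_jQ_{\bm{n}}(\bm{x};\bm{u})={}&\sum_{k=1}^{d-1}(n_k+1)p_ju_j^{(k)}Q_{\bm{n}+\bm{e}_k}(\bm{x};\bm{u})+(N-|\bm{n}|+1)\sum_{l=1}^{d-1}p_ju_j^{(l)}Q_{\bm{n}-\bm{e}_l}(\bm{x};\bm{u})\\ &+\sum_{l,k=1}^{d-1}(n_k+1-\delta_{lk})p_ju_j^{(l)}u_j^{(k)}Q_{\bm{n}-\bm{e}_l+\bm{e}_k}(\bm{x};\bm{u})+p_j(N-|\bm{n}|)Q_{\bm{n}}(\bm{x};\bm{u}), \end{align*} and for $i=1,\ldots,d-1$, \begin{align*} u_iQ_{\bm{n}}(\bm{x};\bm{u})={}&(n_i+1)Q_{\bm{n}+\bm{e}_i}(\bm{x};\bm{u})+(N-|\bm{n}|+1)Q_{\bm{n}-\bm{e}_i}(\bm{x};\bm{u})\\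 &+\sum_{l,k=1}^{d-1}c(i,l,k)(n_k+1-\delta_{kl})Q_{\bm{n}-\bm{e}_l+\bm{e}_k}(\bm{x};\bm{u}). \end{align*}
   Context: $|\cdot|$ denotes the sum of entries of a vector and $\bm{e}_k$ the $k$th standard unit vector. The multivariate Krawtchouk polynomial $Q_{\bm{n}}(\bm{x};\bm{u})$ is the coefficient of $w_1^{n_1}\cdots w_{d-1}^{n_{d-1}}$ in $$\prod_{j=1}^d\Big(1+\sum_{l=1}^{d-1}w_lu_j^{(l)}\Big)^{x_j};$$ it is $0$ when the index has a negative entry or when its entries sum to more than $N$. When $l=k$, $\bm{n}-\bm{e}_l+\bm{e}_k=\bm{n}$. *)

(* Defs.v *)
From HB Require Import structures.
From mathcomp Require Import all_boot all_order all_algebra.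
From mathcomp Require Import mpoly.

Set Implicit Arguments.
Unset Strict Implicit.
Unset Printing Implicit Defensive.

Import Order.TTheory GRing.Theory Num.Theory.
Local Open Scope ring_scope.

(* Conventions.  We write d = m.+1.  The points 1, ..., d and the function
   indices 0, ..., d-1 are both represented by 'I_m.+1; the indices
   1, ..., d-1 are the [up l] for l : 'I_m.  [u l j] is u_j^(l). *)
Definition up (m : nat) (l : 'I_m) : 'I_m.+1 := lift ord0 l.

Definition prob_distr (R : realFieldType) (T : finType) (p : T -> R) : Prop :=
  (forall j, 0 <= p j) /\ \sum_j p j = 1.

Definition orthonormal_on (R : realFieldType) (I T : finType) (p : T -> R)
    (u : I -> T -> R) : Prop :=
  forall l k : I, \sum_j u l j * u k j * p j = (l == k)%:R.

Definition triple_coef (R : realFieldType) (I T : finType) (p : T -> R)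
    (u : I -> T -> R) (i l k : I) : R :=
  \sum_j u i j * u l j * u k j * p j.

Definition vsum (m : nat) (n : 'rV[int]_m) : int := \sum_l n ord0 l.

Definition unit_vec (m : nat) (k : 'I_m) : 'rV[int]_m := delta_mx ord0 k.

Definition krawtchouk_gen (R : realFieldType) (m : nat)
    (u : 'I_m.+1 -> 'I_m.+1 -> R) (x : 'I_m.+1 -> nat) : {mpoly R[m]} :=
  \prod_j (1 + \sum_(l < m) u (up l) j *: 'X_l) ^+ x j.

(* Indices are integer vectors, so that n - e_l makes sense.  No clause is
   needed for indices whose entries sum to more than N = |x|: see
   [krawtchouk_eq0]. *)
Definition krawtchouk (R : realFieldType) (m : nat)
    (u : 'I_m.+1 -> 'I_m.+1 -> R) (x : 'I_m.+1 -> nat) (n : 'rV[int]_m) : R :=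
  if [forall l, 0 <= n ord0 l]
  then (krawtchouk_gen u x)@_[multinom absz (n ord0 l) | l < m]
  else 0.

Lemma krawtchouk_eq0 (R : realFieldType) (m : nat)
    (u : 'I_m.+1 -> 'I_m.+1 -> R) (x : 'I_m.+1 -> nat) (n : 'rV[int]_m) :
  (\sum_j x j)%N%:Z < vsum n -> krawtchouk u x n = 0.
Proof.
rewrite /krawtchouk; case: ifP => // /forallP n_ge0 lt_xn.
apply: memN_msupp_eq0; apply/negP => /msize_mdeg_lt lt_size.
have le_size : (msize (krawtchouk_gen u x) <= (\sum_j x j).+1)%N.
  rewrite {lt_size lt_xn} /krawtchouk_gen.
  have lin j : (msize (1 + \sum_(l < m) u (up l) j *: 'X_l : {mpoly R[m]}) <= 2)%N.
    apply: (leq_trans (msizeD_le _ _)); rewrite geq_max msize1 /=.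
    apply: (leq_trans (msize_sum _ _ _)); apply/bigmax_leqP => l _.
    by apply: (leq_trans (msizeZ_le _ _)); rewrite msizeX mdeg1.
  have mul (q r : {mpoly R[m]}) a b : (msize q <= a.+1)%N ->
      (msize r <= b.+1)%N -> (msize (q * r) <= (a + b).+1)%N.
    have [-> _ _|q0] := eqVneq q 0; first by rewrite mul0r msize0.
    have [-> _ _|r0] := eqVneq r 0; first by rewrite mulr0 msize0.
    move=> qa rb; rewrite msizeM //; move: (leq_add qa rb).
    by rewrite addSn addnS; case: (_ + _)%N => //= k.
  elim/big_rec2: _ => [|j a q _ IH]; first by rewrite msize1.
  apply: (mul _ _ (x j) a) => //; elim: (x j) => [|k IHk]; first by rewrite expr0 msize1.
  by rewrite exprS; apply: (mul _ _ 1%N k).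
move: lt_xn; rewrite /vsum.
have -> : \sum_l n ord0 l = (mdeg [multinom absz (n ord0 l) | l < m])%:Z.
  rewrite mdegE (big_morph Posz PoszD (erefl 0%:Z)); apply: eq_bigr => l _.
  by rewrite mnmE gez0_abs.
by rewrite ltz_nat ltnNge -ltnS (leq_trans lt_size le_size).
Qed.

(* Main.v *)
Require Import Defs.
From mathcomp Require Import all_boot all_order all_algebra.
From mathcomp Require Import mpoly.
From mathcomp Require Import ring zify.

Set Implicit Arguments.
Unset Strict Implicit.
Unset Printing Implicit Defensive.

Import Order.TTheory GRing.Theory Num.Theory.
Local Open Scope ring_scope.

(* Put w_0 = 1 and L_j = \sum_(l <= m) u_j^(l) w_l, so that the generating
   function is G = \prod_j L_j^(x_j), and let D_k = \sum_i x_i u_i^(k) G / L_i.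
   For k >= 1 this is the partial derivative of G in w_k, while D_0 follows
   from Euler's identity \sum_k w_k D_k = N G.  Since the vectors u^(k) are
   also orthonormal in the dual sense \sum_k p_j u_i^(k) u_j^(k) = delta_ij,
   \sum_k p_j u_j^(k) D_k = x_j G / L_j, and multiplication by L_j gives
   x_j G = \sum_(l, k) p_j u_j^(l) u_j^(k) w_l D_k.
   The first recurrence is the coefficient of w^n in this identity, and the
   second one its average against u^(i). *)

(** * Linear algebra of orthonormal systems *)

Lemma orthonormal_dual (R : realFieldType) (T : finType) (p : T -> R)
    (u : T -> T -> R) (hu : orthonormal_on p u) (i j : T) :
  \sum_k p j * u k i * u k j = (i == j)%:R.
Proof.
(* Orthonormality reads [A *m B = 1]. Both matrices are square, so [B *m A = 1] as well, and its
   entries are the dual relations. *)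
pose A := \matrix_(a < #|T|, b < #|T|) u (enum_val a) (enum_val b).
pose B := \matrix_(a < #|T|, b < #|T|)
  (u (enum_val b) (enum_val a) * p (enum_val a)).
have AB : A *m B = 1%:M.
  apply/matrixP => a b; rewrite !mxE -(inj_eq enum_val_inj) -hu.
  rewrite [RHS](reindex (@enum_val T T)) /=; last first.
    exact: onW_bij (enum_val_bij T).
  by apply: eq_bigr => k _; rewrite !mxE mulrA.
have /matrixP/(_ (enum_rank j) (enum_rank i)) := mulmx1C AB.
rewrite !mxE (inj_eq enum_rank_inj) eq_sym => <-.
rewrite (reindex (@enum_val T T)) /=; last exact: onW_bij (enum_val_bij T).
by apply: eq_bigr => k _; rewrite !mxE !enum_rankK; ring.
Qed.

(** * Derivatives of products and powers *)

Lemma mderiv_prod (R : comNzRingType) (m : nat) (k : 'I_m) (I : finType)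
    (f : I -> {mpoly R[m]}) :
  (\prod_i f i)^`M(k) = \sum_i (f i)^`M(k) * \prod_(j | j != i) f j.
Proof.
(* The induction runs over the list of indices; distinctness ensures that the condition [j != i]
   removes exactly one factor. *)
have : uniq (index_enum I) by exact: index_enum_uniq.
elim: (index_enum I) => [_|a r IH /= /andP[ar ur]].
  by rewrite !big_nil -mpolyC1 mderivC.
rewrite !big_cons mderivM IH // eqxx /=; congr (_ * _ + _).
  rewrite big_seq_cond [RHS]big_seq_cond; apply: eq_bigl => j.
  by case: (boolP (j \in r)) => //= jr; apply/esym; apply: contraNneq ar => <-.
rewrite mulr_sumr; apply: eq_big_seq => i ir; rewrite big_cons.
by rewrite ifT; [ring | apply: contraNneq ar => ->].
Qed.

Lemma mderiv_exp (R : comNzRingType) (m : nat) (k : 'I_m) (q : {mpoly R[m]})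
    (a : nat) :
  (q ^+ a)^`M(k) = a%:R * q^`M(k) * q ^+ a.-1.
Proof.
elim: a => [|a IH]; first by rewrite -mpolyC1 mderivC !mul0r.
rewrite exprS mderivM IH; case: a {IH} => [|a] /=; first by ring.
by rewrite [a.+2%:R]mulrS exprS; ring.
Qed.

(** * Coefficients at integer indices *)

Section IntegerCoefficients.
Variables (R : comNzRingType) (m : nat).
Implicit Types (q : {mpoly R[m]}) (n : 'rV[int]_m).

(** Extension by zero to integer indices, with the same test as in [krawtchouk], so that shifts of
    the index carry no side condition. *)
Definition zcoeff q n : R :=
  if [forall l, 0 <= n ord0 l] then q@_[multinom absz (n ord0 l) | l < m]
  else 0.

Lemma zcoeffZ c q n : zcoeff (c *: q) n = c * zcoeff q n.
Proof. by rewrite /zcoeff mcoeffZ; case: ifP => // _; rewrite mulr0. Qed.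

Lemma zcoeff_sum n (I : Type) (s : seq I) (P : pred I) (F : I -> {mpoly R[m]}) :
  zcoeff (\sum_(i <- s | P i) F i) n = \sum_(i <- s | P i) zcoeff (F i) n.
Proof.
by rewrite /zcoeff raddf_sum; case: ifP => // _; rewrite big1.
Qed.

Lemma zcoeff_eq0 q n l : n ord0 l < 0 -> zcoeff q n = 0.
Proof. by rewrite /zcoeff; case: forallP => // /(_ l); rewrite leNgt => /negP. Qed.

Lemma unit_vecE (k l : 'I_m) : unit_vec k ord0 l = (k == l)%:R.
Proof. by rewrite mxE eqxx eq_sym. Qed.

Lemma sub_unit_vecE n l k :
  (n - unit_vec l) ord0 k = n ord0 k - (l == k)%:Z.
Proof. by rewrite mxE [X in _ + X]mxE unit_vecE natz. Qed.

Lemma add_unit_vecE n l k :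
  (n + unit_vec l) ord0 k = n ord0 k + (l == k)%:Z.
Proof. by rewrite mxE unit_vecE natz. Qed.

Lemma zcoeffXM l q n : zcoeff ('X_l * q) n = zcoeff q (n - unit_vec l).
Proof.
rewrite {1}/zcoeff; case: ifP => [/forallP n_ge0|/negbT/forallPn[k nk]]; last first.
  by rewrite (@zcoeff_eq0 _ _ k) // sub_unit_vecE; lia.
(* If [n] vanishes at [l], both sides are 0: multiples of ['X_l] have no such monomial, and the
   shifted index has entry -1. *)
have [nl0|nl_neq0] := eqVneq (n ord0 l) 0.
  rewrite (@zcoeff_eq0 _ _ l) ?sub_unit_vecE ?eqxx ?nl0 //.
  apply: memN_msupp_eq0; rewrite mulrC (perm_mem (msuppMX _ _)).
  apply/mapP => -[k _ /mnmP/(_ l)]; rewrite mnmDE mnm1E mnmE nl0 eqxx; lia.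
rewrite /zcoeff ifT; last first.
  apply/forallP => k; rewrite sub_unit_vecE; move: (n_ge0 k).
  by case: eqP => [<-|_]; move: nl_neq0; lia.
set a := [multinom _ | _ < m]; set b := [multinom _ | _ < m].
suff -> : a = (U_(l) + b)%MM by rewrite mulrC mcoeffMX.
apply/mnmP => k; rewrite mnmDE mnm1E !mnmE sub_unit_vecE; move: (n_ge0 k).
by case: eqP => [<-|_]; move: nl_neq0; lia.
Qed.

Lemma zcoeff_mderiv k q n :
  zcoeff q^`M(k) n = (n ord0 k + 1)%:~R * zcoeff q (n + unit_vec k).
Proof.
rewrite {1}/zcoeff; case: ifP => [/forallP n_ge0|/negbT/forallPn[l nl]]; last first.
  (* Adding [unit_vec k] can cure a negative entry only when that entry is -1 at [k], and then the
     factor is 0. *)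
  have [nk|nk] := eqVneq (n ord0 k + 1) 0; first by rewrite nk mul0r.
  rewrite (@zcoeff_eq0 _ _ l) ?mulr0 // add_unit_vecE.
  by case: eqP nl => [<-|_]; move: nk; lia.
rewrite /zcoeff ifT; last first.
  by apply/forallP => l; rewrite add_unit_vecE; move: (n_ge0 l); lia.
rewrite mcoeff_deriv mnmE -mulr_natl; congr (_ * mcoeff _ q).
  by rewrite -{2}[n ord0 k]gez0_abs // -PoszD addn1 pmulrn.
apply/mnmP => l; rewrite mnmDE mnm1E !mnmE add_unit_vecE; move: (n_ge0 l).
by case: eqP; lia.
Qed.

End IntegerCoefficients.

(** * The generating function and its differential identities *)

Section GeneratingFunction.
Variables (R : realFieldType) (m : nat) (u : 'I_m.+1 -> 'I_m.+1 -> R).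
Variable x : 'I_m.+1 -> nat.

(** The variables w_0 = 1, w_1, ..., w_m. Below, [gen_form], [gen_cofactor] and [gen_diff] are L_j,
    G / L_i and D_k. *)
Definition homog_var (l : 'I_m.+1) : {mpoly R[m]} :=
  oapp (fun k => 'X_k) 1 (unlift ord0 l).

Lemma homog_var0 : homog_var ord0 = 1.
Proof. by rewrite /homog_var unlift_none. Qed.

Lemma homog_var_up k : homog_var (up k) = 'X_k.
Proof. by rewrite /homog_var liftK. Qed.

Definition gen_form (j : 'I_m.+1) : {mpoly R[m]} :=
  \sum_l u l j *: homog_var l.

(* For x i = 0 the truncated exponent makes this G instead of G / L_i; it is
   always multiplied by x i. *)
Definition gen_cofactor (i : 'I_m.+1) : {mpoly R[m]} :=
  gen_form i ^+ (x i).-1 * \prod_(j | j != i) gen_form j ^+ x j.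

Definition gen_diff (k : 'I_m.+1) : {mpoly R[m]} :=
  \sum_i ((x i)%:R * u k i) *: gen_cofactor i.

Hypothesis hu0 : forall j, u ord0 j = 1.

Lemma krawtchouk_genE : krawtchouk_gen u x = \prod_j gen_form j ^+ x j.
Proof.
apply: eq_bigr => j _; congr (_ ^+ _).
rewrite /gen_form big_ord_recl homog_var0 hu0 scale1r; congr (_ + _).
by apply: eq_bigr => l _; rewrite homog_var_up.
Qed.

Lemma gen_cofactorK i :
  (x i)%:R *: (gen_form i * gen_cofactor i) = (x i)%:R *: krawtchouk_gen u x.
Proof.
rewrite krawtchouk_genE (bigD1 i) //= /gen_cofactor mulrA -exprS.
by case: (x i) => [|a] //; rewrite !scale0r.
Qed.

Lemma mderiv_gen_form k j : (gen_form j)^`M(k) = (u (up k) j)%:MP.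
Proof.
rewrite /gen_form big_ord_recl mderivD mderivZ homog_var0 -mpolyC1 mderivC.
rewrite scaler0 add0r raddf_sum (bigD1 k) //= big1 => [|l lk].
  rewrite addr0 mderivZ homog_var_up mderivX mnm1E eqxx scale1r -mul_mpolyC.
  by rewrite -{1}[U_(k)%MM]add0m addmK mpolyX0 mulr1.
rewrite mderivZ homog_var_up mderivX mnm1E (negPf lk).
by rewrite scale0r scaler0.
Qed.

Lemma mderiv_krawtchouk_gen k :
  (krawtchouk_gen u x)^`M(k) = gen_diff (up k).
Proof.
rewrite krawtchouk_genE mderiv_prod; apply: eq_bigr => i _.
rewrite mderiv_exp mderiv_gen_form -mulrA -mpolyC_nat -mpolyCM.
by rewrite mul_mpolyC.
Qed.

(** After exchanging the sums, the sum over k rebuilds L_i, which cancels against G / L_i and leaves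
    x_i G. *)
Lemma euler_gen_diff :
  \sum_k homog_var k * gen_diff k = (\sum_j x j)%N%:R *: krawtchouk_gen u x.
Proof.
rewrite natr_sum scaler_suml.
under eq_bigr do rewrite mulr_sumr.
rewrite exchange_big; apply: eq_bigr => i _.
rewrite -gen_cofactorK mulr_suml scaler_sumr; apply: eq_bigr => k _.
by rewrite -scalerAr -scalerAl scalerA.
Qed.

Lemma gen_expansion (p : 'I_m.+1 -> R) (hu : orthonormal_on p u) j :
  (x j)%:R *: krawtchouk_gen u x =
  \sum_l \sum_k (p j * u l j * u k j) *: (homog_var l * gen_diff k).
Proof.
(* Dual orthogonality isolates the single term i = j of D_k. *)
have dual : \sum_k (p j * u k j) *: gen_diff k = (x j)%:R *: gen_cofactor j.
  have inner i :
      \sum_k p j * u k j * ((x i)%:R * u k i) = (x i)%:R * (i == j)%:R.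
    rewrite -(orthonormal_dual hu) mulr_sumr.
    by apply: eq_bigr => k _; ring.
  under eq_bigr do rewrite scaler_sumr.
  rewrite exchange_big (bigD1 j) //= [X in _ + X]big1 => [|i ij].
    under eq_bigr do rewrite scalerA.
    by rewrite -scaler_suml inner eqxx mulr1 addr0.
  under eq_bigr do rewrite scalerA.
  by rewrite -scaler_suml inner (negPf ij) mulr0 scale0r.
rewrite -gen_cofactorK scalerAr -dual mulr_suml; apply: eq_bigr => l _.
rewrite mulr_sumr; apply: eq_bigr => k _.
by rewrite -scalerAr -scalerAl scalerA; congr (_ *: _); ring.
Qed.

End GeneratingFunction.

(** * Coefficients of the products w_l D_k *)

Section Coefficients.
Variables (R : realFieldType) (m : nat) (u : 'I_m.+1 -> 'I_m.+1 -> R).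
Variable x : 'I_m.+1 -> nat.
Hypothesis hu0 : forall j, u ord0 j = 1.
Let N := (\sum_j x j)%N.
Implicit Type n : 'rV[int]_m.

Lemma zcoeff_krawtchouk_gen n :
  zcoeff (krawtchouk_gen u x) n = krawtchouk u x n.
Proof. by []. Qed.

Definition gen_coeff n (l k : 'I_m.+1) : R :=
  zcoeff (homog_var R l * gen_diff u x k) n.

(** The shift by w_l acts before the derivative, so the derivative contributes the k-th entry of n -
    e_l plus 1; hence the delta. *)
Lemma gen_coeff_up n l k :
  gen_coeff n (up l) (up k) =
  (n ord0 k + 1 - (l == k)%:Z)%:~R
    * krawtchouk u x (n - unit_vec l + unit_vec k).
Proof.
rewrite /gen_coeff homog_var_up zcoeffXM -mderiv_krawtchouk_gen //.
by rewrite zcoeff_mderiv sub_unit_vecE addrAC.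
Qed.

Lemma gen_coeff0_up n k :
  gen_coeff n ord0 (up k) =
  (n ord0 k + 1)%:~R * krawtchouk u x (n + unit_vec k).
Proof.
by rewrite /gen_coeff homog_var0 mul1r -mderiv_krawtchouk_gen // zcoeff_mderiv.
Qed.

Lemma gen_coeff00 n :
  gen_coeff n ord0 ord0 = (N%:Z - vsum n)%:~R * krawtchouk u x n.
Proof.
(* Euler's identity is solved for D_0; each w_k D_k with k >= 1 contributes n_k times the
   coefficient of G at n. *)
have := congr1 (fun q => zcoeff q n) (euler_gen_diff x hu0).
rewrite /= zcoeffZ zcoeff_krawtchouk_gen zcoeff_sum big_ord_recl.
rewrite -/(gen_coeff n ord0 ord0) => /eqP.
rewrite eq_sym -subr_eq eq_sym => /eqP ->.
rewrite rmorphB /= mulrBl; congr (_ - _).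
rewrite /vsum rmorph_sum mulr_suml; apply: eq_bigr => k _ /=.
rewrite homog_var_up zcoeffXM -mderiv_krawtchouk_gen // zcoeff_mderiv subrK.
by rewrite sub_unit_vecE eqxx subrK.
Qed.

Lemma gen_coeff_up0 n l :
  gen_coeff n (up l) ord0 =
  (N%:Z - vsum n + 1)%:~R * krawtchouk u x (n - unit_vec l).
Proof.
(* This is the previous case at n - e_l, whose entries sum to |n| - 1. *)
transitivity (gen_coeff (n - unit_vec l) ord0 ord0).
  by rewrite /gen_coeff homog_var_up homog_var0 mul1r zcoeffXM.
rewrite gen_coeff00; congr (_%:~R * _).
suff -> : vsum (n - unit_vec l) = vsum n - 1 by ring.
have <- : vsum (unit_vec l) = 1.
  rewrite /vsum (bigD1 l) //= unit_vecE eqxx big1 ?addr0 // => k kl.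
  by rewrite unit_vecE eq_sym (negPf kl).
by rewrite -sumrB; apply: eq_bigr => k _; rewrite sub_unit_vecE unit_vecE natz.
Qed.

End Coefficients.

(** * The two recurrences *)

Theorem theorem6 (R : realFieldType) (N m : nat) (hN : (1 <= N)%N)
    (hd : (2 <= m.+1)%N)
    (p : 'I_m.+1 -> R) (hp : prob_distr p) (p_gt0 : forall j, 0 < p j)
    (u : 'I_m.+1 -> 'I_m.+1 -> R) (hu0 : forall j, u ord0 j = 1)
    (hu : orthonormal_on p u)
    (x : 'I_m.+1 -> nat) (hx : (\sum_j x j)%N = N)
    (n : 'rV[int]_m) (hn : forall l, 0 <= n ord0 l) (hnN : vsum n <= N%:Z) :
  let Q := krawtchouk u x in
  let e := @unit_vec m in
  (forall j : 'I_m.+1,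
     (x j)%:R * Q n =
       \sum_(k < m) (n ord0 k + 1)%:~R * p j * u (up k) j * Q (n + e k)
       + (N%:Z - vsum n + 1)%:~R
           * (\sum_(l < m) p j * u (up l) j * Q (n - e l))
       + \sum_(l < m) \sum_(k < m)
           (n ord0 k + 1 - (l == k)%:Z)%:~R * p j * u (up l) j * u (up k) j
             * Q (n - e l + e k)
       + p j * (N%:Z - vsum n)%:~R * Q n)
  /\
  (forall i : 'I_m,
     (\sum_j u (up i) j * (x j)%:R) * Q n =
       (n ord0 i + 1)%:~R * Q (n + e i)
       + (N%:Z - vsum n + 1)%:~R * Q (n - e i)
       + \sum_(l < m) \sum_(k < m)
           triple_coef p u (up i) (up l) (up k)
             * (n ord0 k + 1 - (k == l)%:Z)%:~R * Q (n - e l + e k)).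
Proof.
move=> /=.
have expand j : (x j)%:R * krawtchouk u x n =
    \sum_l \sum_k p j * u l j * u k j * gen_coeff u x n l k.
  have := congr1 (fun q => zcoeff q n) (gen_expansion x hu0 hu j).
  rewrite /= zcoeffZ zcoeff_sum => ->; apply: eq_bigr => l _.
  by rewrite zcoeff_sum; apply: eq_bigr => k _; rewrite zcoeffZ.
(* Splitting by which of l and k is 0 yields the four groups of terms, in the order of the first
   recurrence. *)
have recl (F : 'I_m.+1 -> 'I_m.+1 -> R) : \sum_l \sum_k F l k =
    \sum_k F ord0 (up k) + \sum_l F (up l) ord0
    + \sum_l \sum_k F (up l) (up k) + F ord0 ord0.
  rewrite big_ord_recl big_ord_recl.
  under [X in _ + X]eq_bigr do rewrite big_ord_recl.
  by rewrite big_split /=; ring.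
split=> [j|i].
  rewrite expand recl gen_coeff00 // hx !hu0; congr (_ + _ + _ + _).
  - by apply: eq_bigr => k _; rewrite gen_coeff0_up //; ring.
  - rewrite mulr_sumr; apply: eq_bigr => l _.
    by rewrite gen_coeff_up0 // hx; ring.
  - apply: eq_bigr => l _; apply: eq_bigr => k _.
    by rewrite gen_coeff_up //; ring.
  - by ring.
have -> : (\sum_j u (up i) j * (x j)%:R) * krawtchouk u x n =
    \sum_l \sum_k triple_coef p u (up i) l k * gen_coeff u x n l k.
  rewrite mulr_suml.
  under eq_bigr do rewrite -mulrA expand mulr_sumr.
  rewrite exchange_big; apply: eq_bigr => l _.
  under eq_bigr do rewrite mulr_sumr.
  rewrite exchange_big; apply: eq_bigr => k _.
  by rewrite mulr_suml; apply: eq_bigr => j _; ring.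
(* Since u^(0) = 1, a triple coefficient with an index 0 is an orthonormality relation: the two
   single sums collapse to the index i, and the term l = k = 0 vanishes. *)
have triple0l k : triple_coef p u (up i) ord0 k = (up i == k)%:R.
  by rewrite -hu; apply: eq_bigr => j _; rewrite hu0 mulr1.
have triple0r l : triple_coef p u (up i) l ord0 = (up i == l)%:R.
  by rewrite -hu; apply: eq_bigr => j _; rewrite hu0 mulr1.
have sum_delta (F : 'I_m -> R) : \sum_k (up i == up k)%:R * F k = F i.
  rewrite (bigD1 i) //= eqxx mul1r big1 ?addr0 // => k ki.
  by rewrite (inj_eq lift_inj) eq_sym (negPf ki) mul0r.
rewrite recl triple0l eq_sym (negPf (neq_lift ord0 i)) mul0r addr0.
congr (_ + _ + _).
- by under eq_bigr do rewrite triple0l; rewrite sum_delta gen_coeff0_up.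
- by under eq_bigr do rewrite triple0r; rewrite sum_delta gen_coeff_up0 // hx.
- apply: eq_bigr => l _; apply: eq_bigr => k _.
  by rewrite gen_coeff_up // mulrA eq_sym.
Qed.
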